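(* The equation $$E\left\{\max\left\{\tfrac{T}{2}R_n-\lambda T,\,0\right\}\right\}=\frac{\lambda\tau}{p_s}$$ in the unknown $\lambda\ge 0$ (whose left-hand side does not depend on $n$) always has one and only one solution $\lambda^*$.
   Context: Let $K,L\ge 1$ be integers (numbers of source-destination pairs and of relays), let $T,\tau,P_s,P_r,\sigma_f^2,\sigma_g^2>0$ be constants, let $p_0\in(0,1)$, and put $p_s=Kp_0(1-p_0)^{K-1}$. In observation $n$ ($n=1,2,\dots$), the winner $s(n)$ is uniformly distributed on $\{1,\dots,K\}$ and the channel gains $f_{ij}(n)$ and $g_{ji}(n)$ ($1\le i\le K$, $1\le j\le L$) are (circularly symmetric) complex Gaussian with mean zero and variances $E|f_{ij}(n)|^2=\sigma_f^2$, $E|g_{ji}(n)|^2=\sigma_g^2$. All these random variables are mutually independent, within each observation and across observations. The achievable rate at observation $n$ is $$R_n=\max_{1\le j\le L}\log_2\left(1+\frac{P_sP_r|f_{s(n)j}(n)|^2|g_{js(n)}(n)|^2}{1+P_s|f_{s(n)j}(n)|^2+P_r|g_{js(n)}(n)|^2}\right).$$ The solution $\lambda^*$ has the interpretation of the maximal system throughput. *)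

(* Defs.v *)
From HB Require Import structures.
From mathcomp Require Import all_boot all_order all_algebra.
From mathcomp Require Import complex.
From mathcomp Require Import all_classical all_reals all_analysis.

Set Implicit Arguments.
Unset Strict Implicit.
Unset Printing Implicit Defensive.

Import Order.TTheory GRing.Theory Num.Theory.
Import numFieldNormedType.Exports.

Local Open Scope classical_set_scope.
Local Open Scope ring_scope.

Section random_variables.
Context {d : measure_display} {Omega : measurableType d} {R : realType}.
Variable P : probability Omega R.

(* R[i] carries no measurable structure in the libraries; it is given the
   Borel sigma-algebra of the plane R * R through this identification. *)
Definition ReIm (z : R[i]) : R * R := (complex.Re z, complex.Im z).

Definition complex_law (Z : Omega -> R[i]) : set (R * R) -> \bar R :=
  pushforward P (ReIm \o Z).

(* Z is circularly symmetric complex Gaussian CN(0, v): its real and imaginary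
   parts are independent real Gaussians with mean 0 and variance v / 2, so that
   E |Z|^2 = v.  The second parameter of normal_prob is the standard
   deviation, not the variance. *)
Definition circular_complex_gaussian (v : R) (Z : Omega -> R[i]) : Prop :=
  measurable_fun setT (ReIm \o Z) /\
  forall A : set (R * R), measurable A ->
    complex_law Z A =
    (normal_prob 0 (Num.sqrt (v / 2)) \x normal_prob 0 (Num.sqrt (v / 2)))%E A.

Definition uniform_ord (K : nat) (X : Omega -> 'I_K) : Prop :=
  forall k : 'I_K,
    measurable (X @^-1` [set k]) /\ P (X @^-1` [set k]) = (K%:R^-1)%:E.

Definition sigma_ord (K : nat) (X : Omega -> 'I_K) : set_system Omega :=
  preimage_set_system setT X setT.

Definition sigma_complex (Z : Omega -> R[i]) : set_system Omega :=
  preimage_set_system setT (ReIm \o Z) measurable.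

Definition mutually_independent (I : eqType) (F : I -> set_system Omega) :
    Prop :=
  forall (J : seq I) (E : I -> set Omega), uniq J ->
    (forall i, i \in J -> F i (E i)) ->
    P (\bigcap_(i in [set` J]) E i) = (\big[*%E/1%E]_(i <- J) P (E i))%E.

End random_variables.

(* Indices of the random variables of one observation: the winner, the gains
   f_(i, j) and the gains g_(j, i). *)
Definition obs_index (K L : nat) : eqType :=
  (unit + ('I_K * 'I_L) + ('I_L * 'I_K))%type.

Section relay_network.
Context {d : measure_display} {Omega : measurableType d} {R : realType}.
Variables (P : probability Omega R) (K L : nat).
(* Observation n.+1 of the model has index n. *)
Variables (s : nat -> Omega -> 'I_K).
Variables (f : nat -> 'I_K -> 'I_L -> Omega -> R[i]).
Variables (g : nat -> 'I_L -> 'I_K -> Omega -> R[i]).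

Definition observation_sigma (x : nat * obs_index K L) : set_system Omega :=
  match x.2 with
  | inl (inl _) => sigma_ord (s x.1)
  | inl (inr ij) => sigma_complex (f x.1 ij.1 ij.2)
  | inr ji => sigma_complex (g x.1 ji.1 ji.2)
  end.

Definition log2 (x : R) : R := ln x / ln 2.

Definition sqmod (z : R[i]) : R := ComplexField.Normc.normc z ^+ 2.

(* The terms of the maximum are nonnegative (for Ps, Pr >= 0), so the base
   value 0 of the big maximum is harmless when L >= 1. *)
Definition rate (Ps Pr : R) (n : nat) (w : Omega) : R :=
  \big[Num.max/0]_(j < L)
    log2 (1 + Ps * Pr * sqmod (f n (s n w) j w) * sqmod (g n j (s n w) w) /
              (1 + Ps * sqmod (f n (s n w) j w) + Pr * sqmod (g n j (s n w) w))).

Definition expected_excess (T Ps Pr : R) (lambda : R) (n : nat) : \bar R :=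
  'E_P[fun w => Num.max (T / 2 * rate Ps Pr n w - lambda * T) 0].

End relay_network.

Definition success_probability {R : realType} (K : nat) (p0 : R) : R :=
  K%:R * p0 * (1 - p0) ^+ K.-1.

(* Main.v *)
Require Import Defs.
From HB Require Import structures.
From mathcomp Require Import all_boot all_order all_algebra.
From mathcomp Require Import complex.
From mathcomp Require Import all_classical all_reals all_analysis.
From mathcomp Require Import measurable_realfun ring.

Set Implicit Arguments.
Unset Strict Implicit.
Unset Printing Implicit Defensive.

Import Order.TTheory GRing.Theory Num.Theory.
Import numFieldNormedType.Exports.

Local Open Scope classical_set_scope.
Local Open Scope ring_scope.

(* Within one observation, independence makes the law of the family (winner,
   gains) a product of marginals that do not depend on n; rectangles form a
   pi-system generating the product sigma-algebra, so the expectation of any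
   nonnegative measurable function of the family does not depend on n either.
   The rate is at most a constant times the sum of all the |f_ij|^2, hence
   integrable.  The left-hand side is then finite, nonincreasing and T-Lipschitz
   in lambda, while the right-hand side vanishes at 0 and is strictly
   increasing: the intermediate value theorem gives existence, monotonicity
   gives uniqueness. *)

(** * Expectations and agreement of laws on a pi-system *)

Section equality_in_law.
Context d d' (X : measurableType d) (Y : measurableType d') (R : realType).
Variable P : {finite_measure set X -> \bar R}.

(** Both sides are integrals of [h] against image measures of [P], and finite measures that agree on
    a generating pi-system coincide. *)
Lemma ge0_integral_eq_on_pi_system (G : set_system Y) (phi psi : X -> Y)
    (h : Y -> \bar R) :
  measurable = <<s G >> -> setI_closed G -> G setT ->
  measurable_fun setT phi -> measurable_fun setT psi ->
  (forall A, G A -> P (phi @^-1` A) = P (psi @^-1` A)) ->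
  measurable_fun [set: Y] h -> (forall y, 0 <= h y)%E ->
  (\int[P]_x h (phi x) = \int[P]_x h (psi x))%E.
Proof.
move=> mG setIG GT mphi mpsi PG mh h0.
have pushE f : measurable_fun setT f ->
    (\int[P]_x h (f x) = \int[pushforward P f]_y h y)%E.
  by move=> mf; rewrite ge0_integral_pushforward// preimage_setT.
rewrite (pushE phi)// (pushE psi)//; apply: eq_measure_integral => A mA _.
(* The exhausting sequence of sets of finite measure can be constant, since [P] is finite and [G]
   contains [setT]. *)
apply: (@measure_unique _ _ _ G (fun=> setT) mG setIG) => //=.
- by rewrite bigcup_const//; exists 0%N.
- move=> k; rewrite /pushforward preimage_setT.
  by rewrite -ge0_fin_numE ?fin_num_measure.
Qed.

End equality_in_law.

(** * Joint law of a finite family of points of the plane *)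

Section joint_law.
Context d (Omega : measurableType d) (R : realType) (P : probability Omega R).

(** For finite [I], the pi-system generating the product sigma-algebra; [g_sigma_algebraType] puts
    that sigma-algebra on the function space. *)
Definition rectangle (I : Type) : set_system (I -> R * R) :=
  [set A | exists2 E : I -> set (R * R), (forall i, measurable (E i)) &
     A = [set y | forall i, E i (y i)]].

Lemma measurable_coordinate (I : eqType) (i : I) :
  measurable_fun setT
    (fun y : g_sigma_algebraType (@rectangle I) => y i : R * R).
Proof.
move=> _ B mB; rewrite setTI; apply: sub_sigma_algebra.
exists (fun k => if k == i then B else setT).
  by move=> k; case: eqP.
apply/seteqP; split => [y By k /=|y /(_ i)/=]; last by rewrite eqxx.
by case: eqP => // ->.
Qed.

(** The list [r] exhausts [I], so the preimage of a rectangle is a finite intersection of measurable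
    events. *)
Lemma measurable_fun_family (I : eqType) (r : seq I) (W : I -> Omega -> R * R) :
  (forall i, i \in r) -> (forall i, measurable_fun setT (W i)) ->
  measurable_fun setT
    ((fun w i => W i w) : Omega -> g_sigma_algebraType (@rectangle I)).
Proof.
move=> r_full mW; pose V := g_sigma_algebraType (@rectangle I).
apply: (@measurability _ _ _ V setT _ (@rectangle I)) => //.
move=> _ [_ [E mE ->] <-]; rewrite setTI.
have -> : (fun w i => W i w) @^-1` [set y | forall i, E i (y i)] =
    \bigcap_(i in [set` r]) (W i @^-1` E i).
  apply/seteqP; split => [w /= Ew i _|w /= Ew i]; first exact: Ew.
  exact: Ew (r_full i).
apply: fin_bigcap_measurable => // i _.
by rewrite -[X in measurable X]setTI; exact: mW.
Qed.

(** Independence factors the probability of a rectangle into marginals, and these agree for [Y] (at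
    time [n]) and [Z] (at time [m]). *)
Lemma ge0_integral_eq_joint_law (I : eqType) (F : nat * I -> set_system Omega)
    (r : seq I) (Y Z : I -> Omega -> R * R) (n m : nat)
    (h : g_sigma_algebraType (@rectangle I) -> \bar R) :
  uniq r -> (forall i, i \in r) ->
  mutually_independent P F ->
  (forall i B, measurable B -> F (n, i) (Y i @^-1` B)) ->
  (forall i B, measurable B -> F (m, i) (Z i @^-1` B)) ->
  (forall i, measurable_fun setT (Y i)) ->
  (forall i, measurable_fun setT (Z i)) ->
  (forall i B, measurable B -> P (Y i @^-1` B) = P (Z i @^-1` B)) ->
  measurable_fun setT h -> (forall y, 0 <= h y)%E ->
  (\int[P]_w h (fun i => Y i w) = \int[P]_w h (fun i => Z i w))%E.
Proof.
move=> r_uniq r_full indep FY FZ mY mZ YZ mh h0.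
have rectE (k : nat) (W : I -> Omega -> R * R) (E : I -> set (R * R)) :
    (forall i B, measurable B -> F (k, i) (W i @^-1` B)) ->
    (forall i, measurable (E i)) ->
    (P ((fun w i => W i w) @^-1` [set y | forall i, E i (y i)]) =
     \big[*%E/1%E]_(i <- r) P (W i @^-1` E i))%E.
  (* Independence ranges over all pairs of a time and an index; here it is restricted to the pairs
     of time [k]. *)
  move=> FW mE; have := indep (map (pair k) r) (fun p => W p.2 @^-1` E p.2).
  rewrite map_inj_uniq ?r_uniq => [|i j [//]].
  rewrite big_map => <- //; last by move=> _ /mapP[i _ ->]; exact: FW.
  congr (P _); apply/seteqP.
  split => [w /= Ew p _ /=|w /= Ew i]; first exact: Ew.
  by apply: (Ew (k, i)); rewrite /= map_f.
apply: (@ge0_integral_eq_on_pi_system _ _ _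
    (g_sigma_algebraType (@rectangle I)) _ _ (@rectangle I)) => //.
- move=> _ _ [E mE ->] [E' mE' ->]; exists (fun i => E i `&` E' i).
    by move=> i; exact: measurableI.
  by apply/seteqP; split => [y [Ey E'y] i|y EE'y]; split=> // i; case: (EE'y i).
- by exists (fun=> setT) => //; apply/seteqP; split.
- exact: (measurable_fun_family r_full).
- exact: (measurable_fun_family r_full).
- move=> _ [E mE ->]; apply: (etrans (rectE n Y E FY mE)).
  apply: (etrans _ (esym (rectE m Z E FZ mE))).
  by apply: eq_bigr => i _; exact: YZ.
Qed.

End joint_law.

Lemma measurable_bigmaxr d (X : measurableType d) (R : realType) (I : Type)
    (r : seq I) (D : set X) (h : I -> X -> R) :
  (forall i, measurable_fun D (h i)) ->
  measurable_fun D (fun x => \big[Num.max/0]_(i <- r) h i x).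
Proof.
move=> mh; elim: r => [|i r IH].
  by under eq_fun do rewrite big_nil; exact: measurable_cst.
by under eq_fun do rewrite big_cons; exact: measurable_maxr.
Qed.

(** * Crossing of the expected excess with a line through the origin *)

Section excess.
Context d (Omega : measurableType d) (R : realType) (P : probability Omega R).
Variables (X : Omega -> R) (T : R).
Hypotheses (intX : P.-integrable setT (EFin \o X)) (T_gt0 : 0 < T).

Let excess (l : R) (w : Omega) : R := Num.max (X w - l * T) 0.

Let integrable_excess l : P.-integrable setT (EFin \o excess l).
Proof.
have mX : measurable_fun setT X.
  by apply/measurable_EFinP; exact: measurable_int intX.
have mT : measurable [set: Omega] by [].
apply: (@le_integrable _ _ _ _ _ mT _
    (fun w => (X w)%:E - (l * T)%:E)%E).
- apply/measurable_EFinP; apply: measurable_maxr => //.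
  exact: measurable_funB.
- move=> w _; rewrite lee_fin /excess maxEle.
  by case: ifP => // _; rewrite normr0.
- by apply: integrableB => //; exact: (finite_measure_integrable_cst P _ mT).
Qed.

Let phi l := fine ('E_P[excess l])%E.

Let phiE l : ('E_P[excess l] = (phi l)%:E)%E.
Proof.
rewrite fineK// unlock; apply: integrable_fin_num => //.
exact: integrable_excess.
Qed.

(** Both bounds hold pointwise for [excess], because raising the threshold by [T * (m - l)] lowers a
    positive part by at most that amount; they are then integrated. *)
Let phi_le l m : l <= m -> phi m <= phi l <= phi m + T * (m - l).
Proof.
move=> lm; rewrite -!lee_fin EFinD -!phiE.
have lmT : l * T <= m * T by rewrite ler_pM2r.
rewrite -(expectation_cst P (T * (m - l))) !unlock; apply/andP; split.
  apply: le_integral => //; try exact: integrable_excess.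
  move=> w _; rewrite lee_fin /excess ge_max le_max le_max lexx orbT andbT.
  by rewrite lerB.
have mT : measurable [set: Omega] by [].
have intc : P.-integrable setT (EFin \o (cst (T * (m - l)))).
  exact: finite_measure_integrable_cst.
have intm := integrable_excess m.
rewrite -(integralD mT intm intc).
apply: (le_integral mT (integrable_excess l) (integrableD mT intm intc)).
move=> w _; rewrite -EFinD lee_fin /excess/= ge_max; apply/andP; split.
  have -> : X w - l * T = (X w - m * T) + T * (m - l) by ring.
  by rewrite lerD2r le_max lexx.
by rewrite addr_ge0// ?le_max ?lexx ?orbT// mulr_ge0 ?subr_ge0// ltW.
Qed.

Lemma expected_excess_unique_crossing (c : R) : 0 < c ->
  exists l, unique
    (fun l : R => 0 <= l /\
       expectation P (fun w => Num.max (X w - l * T) 0) = (l * c)%:E) l.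
Proof.
move=> c_gt0.
have phi_ge0 l : 0 <= phi l.
  by rewrite -lee_fin -phiE expectation_ge0// => w; rewrite le_max lexx orbT.
have phi_lipschitz l m : `|phi l - phi m| <= T * `|l - m|.
  wlog lm : l m / l <= m.
    move=> H; have [|/ltW] := leP l m; first exact: H.
    by rewrite distrC (distrC l); exact: H.
  have /andP[ml lmT] := phi_le lm.
  by rewrite ger0_norm ?subr_ge0// distrC ger0_norm ?subr_ge0// lerBlDl.
pose gap l := l * c - phi l.
have gap_incr l m : l < m -> gap l < gap m.
  move=> lm; have /andP[ml _] := phi_le (ltW lm).
  by rewrite /gap ltr_leB// ltr_pM2r.
have cgap : continuous gap.
  move=> x; apply: cvgB; first by apply: cvgM; [exact: cvg_id|exact: cvg_cst].
  apply/cvgrPdist_lt => e e0; near=> y.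
  apply: (le_lt_trans (phi_lipschitz _ _)); rewrite mulrC -ltr_pdivlMr//.
  near: y; apply: (@cvgr_dist_lt _ _ _ _ _ id) => //; exact: divr_gt0.
(* Right end of the interval for the intermediate value theorem: there the line has height [phi 0],
   which bounds the nonincreasing [phi]. *)
have b_ge0 : 0 <= phi 0 / c by rewrite divr_ge0// ltW.
have gap0 : gap 0 <= 0 by rewrite /gap mul0r sub0r oppr_le0.
have gapb : 0 <= gap (phi 0 / c).
  by rewrite /gap divfK ?gt_eqF// subr_ge0; case/andP: (phi_le b_ge0).
have [||l] := @IVT R gap 0 (phi 0 / c) 0 b_ge0.
- exact: continuous_subspaceT.
- by rewrite ge_min gap0 le_max gapb orbT.
rewrite in_itv/= => /andP[l_ge0 _] gapl; exists l; split.
  by move/eqP: gapl; rewrite /gap subr_eq0 phiE => /eqP->.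
move=> m [_]; rewrite phiE => -[phim].
have gapm : gap m = 0 by rewrite /gap phim subrr.
case: (ltgtP l m) => // /gap_incr; rewrite gapl gapm ltxx.
Unshelve. all: by end_near. Qed.

End excess.

(** * Second moment of a real Gaussian *)

Section normal_second_moment.
Context {R : realType}.
Local Notation mu := (@lebesgue_measure R).

Lemma ge0_integral_normal_prob (m s : R) (h : R -> \bar R) :
  measurable_fun setT h -> (forall x, 0 <= h x)%E ->
  (\int[normal_prob m s]_x h x = \int[mu]_x (h x * (normal_pdf m s x)%:E))%E.
Proof.
move=> mh h0; have dom := normal_prob_dominates m s.
have iRN := Radon_Nikodym_SigmaFinite.f_integrable dom.
have mpdf : measurable_fun setT (EFin \o normal_pdf m s).
  by apply/measurable_EFinP; exact: measurable_normal_pdf.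
rewrite -(Radon_Nikodym_SigmaFinite.change_of_variables dom h0)//.
apply: ae_eq_integral => //.
- by apply: emeasurable_funM => //; exact: measurable_int iRN.
- exact: emeasurable_funM.
(* The Radon-Nikodym derivative and [normal_pdf] have the same integral over every measurable set,
   hence agree almost everywhere. *)
- apply: ae_eqe_mul2l; apply: integral_ae_eq => //.
  by move=> E _ mE; rewrite -Radon_Nikodym_SigmaFinite.f_integral.
Qed.

(* [u <= exp u] at u = x^2 / (4 s^2) trades the factor x^2 for a doubling of
   the variance in the density. *)
Lemma normal_pdf_sqr_le (s x : R) : 0 < s ->
  x ^+ 2 * normal_pdf 0 s x <=
  4 * s ^+ 2 * (normal_peak s / normal_peak (Num.sqrt 2 * s)) *
  normal_pdf 0 (Num.sqrt 2 * s) x.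
Proof.
move=> s_gt0; have t_gt0 : 0 < Num.sqrt 2 * s by rewrite mulr_gt0.
have pt : normal_peak (Num.sqrt 2 * s) != 0.
  by rewrite gt_eqF// normal_peak_gt0// gt_eqF.
rewrite !normal_pdfE ?gt_eqF// /normal_fun !subr0 exprMn sqr_sqrtr//.
set u := x ^+ 2 / (4 * s ^+ 2); have s_neq0 : s != 0 by rewrite gt_eqF.
have -> : - x ^+ 2 / (s ^+ 2 *+ 2) = - u - u by rewrite /u; field.
have -> : - x ^+ 2 / (2 * s ^+ 2 *+ 2) = - u by rewrite /u; field.
have -> : x ^+ 2 = 4 * s ^+ 2 * u by rewrite /u; field.
rewrite expRD; set e := expR (- u); set p := normal_peak s.
have ue : u * e <= 1.
  rewrite /e expRN ler_pdivrMr ?expR_gt0// mul1r.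
  by apply: le_trans (expR_ge1Dx u); rewrite lerDr.
rewrite [leLHS](_ : _ = 4 * s ^+ 2 * (p * e) * (u * e)); last by ring.
rewrite [leRHS](_ : _ = 4 * s ^+ 2 * (p * e) * 1); last by field.
apply: ler_wpM2l => //.
exact: (mulr_ge0 (mulr_ge0 (ler0n _ 4) (sqr_ge0 s))
  (mulr_ge0 (normal_peak_ge0 s) (expR_ge0 _))).
Qed.

(** The integrand is at most [C] times the normal density of variance [2 * s ^+ 2], whose integral
    is 1. *)
Lemma normal_prob_second_moment_lty (s : R) : 0 < s ->
  (\int[normal_prob 0 s]_x (x ^+ 2)%:E < +oo)%E.
Proof.
move=> s_gt0; rewrite ge0_integral_normal_prob; last 2 first.
- by apply/measurable_EFinP; exact: measurable_funX.
- by move=> x; rewrite lee_fin sqr_ge0.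
set C := 4 * s ^+ 2 * (normal_peak s / normal_peak (Num.sqrt 2 * s)).
have C_ge0 : 0 <= C.
  by apply: mulr_ge0; [exact: (mulr_ge0 (ler0n _ 4) (sqr_ge0 s))|
    exact: divr_ge0 (normal_peak_ge0 _) (normal_peak_ge0 _)].
set t := Num.sqrt 2 * s.
have mpdf v : measurable_fun setT (EFin \o @normal_pdf R 0 v).
  by apply/measurable_EFinP; exact: measurable_normal_pdf.
apply: (@le_lt_trans _ _ (\int[mu]_x (C%:E * (normal_pdf 0 t x)%:E))%E).
  apply: ge0_le_integral => //.
  - by move=> x _; rewrite mule_ge0// lee_fin ?sqr_ge0 ?normal_pdf_ge0.
  - apply: emeasurable_funM; last exact: mpdf.
    by apply/measurable_EFinP; exact: measurable_funX.
  - by apply: emeasurable_funM; [exact: measurable_cst|exact: mpdf].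
  - by move=> x _; rewrite -!EFinM lee_fin; exact: normal_pdf_sqr_le.
rewrite ge0_integralZl//; last 2 first.
- exact: mpdf.
- by move=> x _; rewrite lee_fin normal_pdf_ge0.
by rewrite integral_normal_pdf mule1 ltry.
Qed.


End normal_second_moment.

(** * Integrability of the squared modulus of a Gaussian gain *)

Section gaussian_gain.
Context d (Omega : measurableType d) (R : realType) (P : probability Omega R).

Lemma sqmodE (z : R[i]) : sqmod z = (ReIm z).1 ^+ 2 + (ReIm z).2 ^+ 2.
Proof. by case: z => a b; rewrite /sqmod /= sqr_sqrtr// addr_ge0// sqr_ge0. Qed.

Lemma integrable_sqr_normal_law (s : R) (X : Omega -> R) : 0 < s ->
  measurable_fun setT X ->
  (forall A, measurable A -> P (X @^-1` A) = normal_prob 0 s A) ->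
  P.-integrable setT (fun w => (X w ^+ 2)%:E).
Proof.
move=> s_gt0 mX lawX; apply/integrableP; split.
  by apply/measurable_EFinP; exact: measurable_funX.
under eq_integral do rewrite gee0_abs ?lee_fin ?sqr_ge0//.
(* [normal_prob] is a measure on the generated-sigma-algebra alias of [R], which
   has the same measurable sets as [R] but another display. *)
pose X' : Omega -> g_sigma_algebraType (R.-ocitv.-measurable) := X.
have mX' : measurable_fun setT X' by exact: mX.
have -> : (\int[P]_w (X w ^+ 2)%:E =
    \int[pushforward P X']_x (x ^+ 2)%:E)%E.
  rewrite ge0_integral_pushforward ?preimage_setT//.
    by apply/measurable_EFinP; exact: measurable_funX.
  by move=> x _; rewrite lee_fin sqr_ge0.
rewrite (@eq_measure_integral _ _ _ _ (normal_prob 0 s)).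
  exact: normal_prob_second_moment_lty.
by move=> A mA _; exact: lawX.
Qed.

(** The squared modulus is the sum of the squares of the two parts, and each part has a normal law
    as a marginal of the product law. *)
Lemma integrable_sqmod_gaussian (v : R) (Z : Omega -> R[i]) : 0 < v ->
  circular_complex_gaussian P v Z ->
  P.-integrable setT (fun w => (sqmod (Z w))%:E).
Proof.
move=> v_gt0 [mZ lawZ]; have s_gt0 : 0 < Num.sqrt (v / 2).
  by rewrite sqrtr_gt0 divr_gt0.
have N1 : normal_prob 0 (Num.sqrt (v / 2)) setT = 1%E.
  exact: probability_setT.
under eq_fun do rewrite sqmodE EFinD.
apply: integrableD => //; apply: (integrable_sqr_normal_law s_gt0).
- exact: measurableT_comp mZ.
(* The marginal is read off a strip: the free factor contributes its total mass [N1]. *)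
- move=> A mA; transitivity (complex_law P Z (A `*` setT)).
    by congr (P _); apply/seteqP; split => w /=; [|case].
  rewrite lawZ; last exact: measurableX.
  by rewrite product_measure1E// -[RHS]mule1; congr (_ * _)%E; exact: N1.
- exact: measurableT_comp mZ.
- move=> A mA; transitivity (complex_law P Z (setT `*` A)).
    by congr (P _); apply/seteqP; split => w /=; [|case].
  rewrite lawZ; last exact: measurableX.
  by rewrite product_measure1E// -[RHS]mul1e; congr (_ * _)%E; exact: N1.
Qed.

End gaussian_gain.

(** * The rate as a function of one observation *)

Section relay_rate.
Context d (Omega : measurableType d) (R : realType) (P : probability Omega R).
Variables (K L : nat) (s : nat -> Omega -> 'I_K).
Variables (f : nat -> 'I_K -> 'I_L -> Omega -> R[i]).
Variables (g : nat -> 'I_L -> 'I_K -> Omega -> R[i]).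

(* The winner is embedded in the plane so that all coordinates of an
   observation live in the same space. *)
Definition observation (n : nat) (i : obs_index K L) (w : Omega) : R * R :=
  match i with
  | inl (inl _) => ((s n w : nat)%:R, 0)
  | inl (inr ij) => ReIm (f n ij.1 ij.2 w)
  | inr ji => ReIm (g n ji.1 ji.2 w)
  end.

(** The squared modulus of the winner's channel. Summing against indicators replaces the random
    index by a finite sum that is visibly measurable in the coordinates. *)
Definition winner_gain (y : obs_index K L -> R * R)
    (channel : 'I_K -> obs_index K L) : R :=
  \sum_(k < K) \1_[set k%:R] (y (inl (inl tt))).1 *
    ((y (channel k)).1 ^+ 2 + (y (channel k)).2 ^+ 2).

(* With a and b the two received powers,
   1 + a b / (1 + a + b) = (1 + a) (1 + b) / (1 + a + b). *)
Definition rate_of_observation (Ps Pr : R) (y : obs_index K L -> R * R) : R :=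
  \big[Num.max/0]_(j < L)
    let a := Ps * winner_gain y (fun k => inl (inr (k, j))) in
    let b := Pr * winner_gain y (fun k => inr (j, k)) in
    (ln (1 + a) + ln (1 + b) - ln (1 + a + b)) / ln 2.

Lemma winner_gain_observation n w channel :
  winner_gain (observation n ^~ w) channel =
  (observation n (channel (s n w)) w).1 ^+ 2 +
  (observation n (channel (s n w)) w).2 ^+ 2.
Proof.
rewrite /winner_gain (bigD1 (s n w))//= indicE mem_set// mul1r big1 ?addr0//.
move=> k ks; rewrite indicE memNset ?mul0r//= => /eqP.
by rewrite eqr_nat => /eqP/val_inj sk; rewrite sk eqxx in ks.
Qed.

Lemma ln1D_mul_div (a b : R) : 0 <= a -> 0 <= b ->
  ln (1 + a * b / (1 + a + b)) = ln (1 + a) + ln (1 + b) - ln (1 + a + b).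
Proof.
move=> a0 b0; have ab : 0 < 1 + a + b by rewrite -addrA ltr_pwDl// addr_ge0.
have a1 : 0 < 1 + a by rewrite ltr_pwDl.
have b1 : 0 < 1 + b by rewrite ltr_pwDl.
rewrite -lnM ?posrE// -ln_div ?posrE ?mulr_gt0//; congr ln.
by field; rewrite gt_eqF.
Qed.

Lemma sqmod_ge0 (z : R[i]) : 0 <= sqmod z.
Proof. exact: sqr_ge0. Qed.

(** The function on the right does not involve [n], so the rate depends on time only through the
    observation. *)
Lemma rateE Ps Pr n w : 0 <= Ps -> 0 <= Pr ->
  rate s f g Ps Pr n w = rate_of_observation Ps Pr (observation n ^~ w).
Proof.
move=> Ps0 Pr0; apply: eq_bigr => j _; rewrite !winner_gain_observation/=.
rewrite -!sqmodE /log2; congr (_ / _).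
set x := sqmod (f _ _ _ _); set y := sqmod (g _ _ _ _).
rewrite -ln1D_mul_div; [|exact: mulr_ge0 Ps0 (sqmod_ge0 _)|
                         exact: mulr_ge0 Pr0 (sqmod_ge0 _)].
by congr (ln (1 + _ / _)); ring.
Qed.

Lemma rate_ge0 Ps Pr n w : 0 <= rate s f g Ps Pr n w.
Proof. exact: bigmax_ge_id. Qed.

(** Uses [ln (1 + z) <= z] and [a * b / (1 + a + b) <= a]. Summing over all [j] and [k] removes both
    the maximum and the random winner from the bound. *)
Lemma rate_le Ps Pr n w : 0 <= Ps -> 0 <= Pr ->
  rate s f g Ps Pr n w <=
  \sum_(j < L) \sum_(k < K) Ps / ln 2 * sqmod (f n k j w).
Proof.
move=> Ps0 Pr0; have ln2_gt0 : 0 < ln 2 :> R by rewrite ln_gt0// ltr1n.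
have term_ge0 j k : 0 <= Ps / ln 2 * sqmod (f n k j w).
  by apply: mulr_ge0 (sqmod_ge0 _); rewrite divr_ge0// ltW.
apply: bigmax_le => [|j _]; first by do 2![apply: sumr_ge0 => ? _].
rewrite (bigD1 j)//= -[leLHS]addr0 lerD//; last first.
  by do 2![apply: sumr_ge0 => ? _].
rewrite (bigD1 (s n w))//= -[leLHS]addr0 lerD ?sumr_ge0//.
rewrite /log2 [leRHS]mulrAC ler_pM2r ?invr_gt0//.
have a0 := mulr_ge0 Ps0 (sqmod_ge0 (f n (s n w) j w)).
have b0 := mulr_ge0 Pr0 (sqmod_ge0 (g n j (s n w) w)).
set x := sqmod (f _ _ _ _) in a0 *; set y := sqmod (g _ _ _ _) in b0 *.
have -> : Ps * Pr * x * y = (Ps * x) * (Pr * y) by ring.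
move: (Ps * x) (Pr * y) a0 b0 => a b a0 b0.
have ab : 0 < 1 + a + b by rewrite -addrA ltr_pwDl// addr_ge0.
have z0 : 0 <= a * b / (1 + a + b) by apply: divr_ge0 (mulr_ge0 a0 b0) (ltW ab).
apply: (le_trans (le_ln1Dx (lt_le_trans (ltrN10 _) z0))).
rewrite ler_pdivrMr//; apply: ler_wpM2l => //.
by rewrite lerDr addr_ge0.
Qed.

(** Written as a difference of logarithms, the rate involves no division by a random quantity. *)
Lemma measurable_rate_of_observation Ps Pr :
  measurable_fun setT (rate_of_observation Ps Pr :
    g_sigma_algebraType (@rectangle R (obs_index K L)) -> R).
Proof.
have mcoord (i : obs_index K L) := @measurable_coordinate R _ i.
have mgain channel : measurable_fun setT (winner_gain ^~ channel :
    g_sigma_algebraType (@rectangle R (obs_index K L)) -> R).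
  apply: measurable_sum => k; apply: measurable_funM.
    apply: measurableT_comp (measurableT_comp measurable_fst (mcoord _)).
    exact: measurable_indic.
  by apply: measurable_funD; apply: measurable_funX;
    [apply: measurableT_comp measurable_fst _|
     apply: measurableT_comp measurable_snd _]; exact: mcoord.
apply: measurable_bigmaxr => j.
apply: measurable_funM => //; apply: measurable_funB.
  by apply: measurable_funD; apply: measurableT_comp; [exact: measurable_ln|
    apply: measurable_funD => //; exact: measurable_funM|
    exact: measurable_ln|
    apply: measurable_funD => //; exact: measurable_funM].
apply: measurableT_comp; first exact: measurable_ln.
by do ![apply: measurable_funD => //]; exact: measurable_funM.
Qed.

End relay_rate.

(** * Law of the winner *)

Section uniform_winner.
Context d (Omega : measurableType d) (R : realType) (P : probability Omega R).
Variable K : nat.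

Lemma preimage_ord (X : Omega -> 'I_K) (D : set 'I_K) :
  X @^-1` D = \bigcup_(k in D) X @^-1` [set k].
Proof.
by apply/seteqP; split => [w Dw|w [k Dk /= ->]//]; exists (X w).
Qed.

Lemma measurable_preimage_uniform (X : Omega -> 'I_K) (D : set 'I_K) :
  uniform_ord P X -> measurable (X @^-1` D).
Proof.
move=> uX; rewrite preimage_ord; apply: fin_bigcup_measurable => // k _.
by case: (uX k).
Qed.

(** On a finite set a law is determined by its atoms, here all of mass [K%:R^-1]. *)
Lemma uniform_ord_law (X X' : Omega -> 'I_K) (D : set 'I_K) :
  uniform_ord P X -> uniform_ord P X' -> P (X @^-1` D) = P (X' @^-1` D).
Proof.
have sumE Y : uniform_ord P Y ->
    (P (Y @^-1` D) = \sum_(k \in D) P (Y @^-1` [set k]))%E.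
  move=> uY; rewrite preimage_ord measure_fin_bigcup//.
  - exact: finite_finset.
  - by move=> i j _ _ [w [/= <- <-]].
  - by move=> k _; case: (uY k).
move=> uX uX'; rewrite !sumE//; apply: eq_fsbigr => k _.
by case: (uX k) => _ ->; case: (uX' k).
Qed.

End uniform_winner.

(** * Stationarity and integrability for the relay network *)

Section relay_excess.
Context d (Omega : measurableType d) (R : realType) (P : probability Omega R).
Variables (K L : nat) (T Ps Pr sigma2f sigma2g : R).
Variables (s : nat -> Omega -> 'I_K).
Variables (f : nat -> 'I_K -> 'I_L -> Omega -> R[i]).
Variables (g : nat -> 'I_L -> 'I_K -> Omega -> R[i]).
Hypotheses (Ps_ge0 : 0 <= Ps) (Pr_ge0 : 0 <= Pr) (sigma2f_gt0 : 0 < sigma2f).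
Hypothesis s_uniform : forall n, uniform_ord P (s n).
Hypothesis f_gaussian :
  forall n i j, circular_complex_gaussian P sigma2f (f n i j).
Hypothesis g_gaussian :
  forall n j i, circular_complex_gaussian P sigma2g (g n j i).

Let measurable_observation n i : measurable_fun setT (observation s f g n i).
Proof.
case: i => [[u|ij]|ji]; [|by case: (f_gaussian n ij.1 ij.2)|
                          by case: (g_gaussian n ji.1 ji.2)].
move=> _ B mB; rewrite setTI.
exact: (measurable_preimage_uniform [set k : 'I_K | B ((k : nat)%:R, 0)]).
Qed.

(** [obs_index K L] is declared as an [eqType]; its finiteness is recovered from the underlying sum
    type. *)
Let obs_enum : seq (obs_index K L) :=
  enum {: unit + 'I_K * 'I_L + 'I_L * 'I_K}.

Let mem_obs_enum (i : obs_index K L) : i \in obs_enum.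
Proof. exact: mem_enum. Qed.

Let measurable_rate n : measurable_fun setT (rate s f g Ps Pr n).
Proof.
have -> : rate s f g Ps Pr n =
    fun w => rate_of_observation Ps Pr (observation s f g n ^~ w).
  by apply/funext => w; exact: rateE.
apply: measurableT_comp (measurable_rate_of_observation Ps Pr) _.
exact: (measurable_fun_family mem_obs_enum).
Qed.

(** The excess is one nonnegative measurable function [h] of the observation, and corresponding
    coordinates at times [n] and [m] have equal laws. *)
Lemma expected_excess_stationary (lambda : R) (n m : nat) :
  mutually_independent P (observation_sigma s f g) ->
  expected_excess P s f g T Ps Pr lambda n =
  expected_excess P s f g T Ps Pr lambda m.
Proof.
move=> indep; rewrite /expected_excess !unlock.
pose h (y : g_sigma_algebraType (@rectangle R (obs_index K L))) : \bar R :=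
  (Num.max (T / 2 * rate_of_observation Ps Pr y - lambda * T) 0)%:E.
under eq_integral do rewrite rateE//.
under [RHS]eq_integral do rewrite rateE//.
have sigma_obs k (i : obs_index K L) (B : set (R * R)) : measurable B ->
    observation_sigma s f g (k, i) (observation s f g k i @^-1` B).
  move=> mB; case: i => [[u|ij]|ji]; last 2 first.
  - by exists B => //; rewrite setTI.
  - by exists B => //; rewrite setTI.
  by exists [set j : 'I_K | B ((j : nat)%:R, 0)] => //; rewrite setTI.
apply: (@ge0_integral_eq_joint_law _ _ _ P _ _ obs_enum
  (observation s f g n) (observation s f g m) n m h (enum_uniq _)
  mem_obs_enum indep (sigma_obs n) (sigma_obs m)) => //.
- case=> [[u|ij]|ji] B mB.
  + exact: (uniform_ord_law [set k : 'I_K | B ((k : nat)%:R, 0)]).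
  + have [_ lawn] := f_gaussian n ij.1 ij.2.
    have [_ lawm] := f_gaussian m ij.1 ij.2.
    exact: (etrans (lawn B mB) (esym (lawm B mB))).
  + have [_ lawn] := g_gaussian n ji.1 ji.2.
    have [_ lawm] := g_gaussian m ji.1 ji.2.
    exact: (etrans (lawn B mB) (esym (lawm B mB))).
- apply/measurable_EFinP; apply: measurable_maxr => //.
  apply: measurable_funB => //; apply: measurable_funM => //.
  exact: measurable_rate_of_observation.
- by move=> y; rewrite lee_fin le_max lexx orbT.
Qed.

Lemma integrable_rate n : P.-integrable setT (EFin \o rate s f g Ps Pr n).
Proof.
have mT : measurable [set: Omega] by [].
pose bound w := (\sum_(j < L) \sum_(k < K)
  (Ps / ln 2)%:E * (sqmod (f n k j w))%:E)%E.
apply: (@le_integrable _ _ _ _ _ mT _ bound).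
- exact/measurable_EFinP.
- move=> w _; rewrite /= ger0_norm ?rate_ge0//.
  rewrite (le_trans _ (lee_abs _))// /bound.
  under eq_bigr do (under eq_bigr do rewrite -EFinM; rewrite sumEFin).
  by rewrite sumEFin lee_fin; exact: rate_le.
apply: integrable_sum => // j _; apply: integrable_sum => // k _.
apply: integrableZl => //.
exact: integrable_sqmod_gaussian (f_gaussian _ _ _).
Qed.

End relay_excess.

(** * Existence and uniqueness of the throughput *)

Theorem theorem2 (d : measure_display) (Omega : measurableType d)
  (R : realType) (P : probability Omega R) (K L : nat)
  (T tau Ps Pr sigma2f sigma2g p0 : R)
  (s : nat -> Omega -> 'I_K)
  (f : nat -> 'I_K -> 'I_L -> Omega -> R[i])
  (g : nat -> 'I_L -> 'I_K -> Omega -> R[i])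
  (K_ge1 : (1 <= K)%N) (L_ge1 : (1 <= L)%N)
  (T_gt0 : 0 < T) (tau_gt0 : 0 < tau) (Ps_gt0 : 0 < Ps) (Pr_gt0 : 0 < Pr)
  (sigma2f_gt0 : 0 < sigma2f) (sigma2g_gt0 : 0 < sigma2g)
  (p0_gt0 : 0 < p0) (p0_lt1 : p0 < 1)
  (s_uniform : forall n, uniform_ord P (s n))
  (f_gaussian : forall n i j, circular_complex_gaussian P sigma2f (f n i j))
  (g_gaussian : forall n j i, circular_complex_gaussian P sigma2g (g n j i))
  (independent : mutually_independent P (observation_sigma s f g)) :
  (forall (lambda : R) (n m : nat), 0 <= lambda ->
     expected_excess P s f g T Ps Pr lambda n =
     expected_excess P s f g T Ps Pr lambda m) /\
  exists lambda_star : R, forall n : nat,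
    unique (fun lambda : R =>
              0 <= lambda /\
              expected_excess P s f g T Ps Pr lambda n =
              (lambda * tau / success_probability K p0)%:E)
           lambda_star.
Proof.
have Ps_ge0 := ltW Ps_gt0; have Pr_ge0 := ltW Pr_gt0.
have stationary lambda n m : expected_excess P s f g T Ps Pr lambda n =
    expected_excess P s f g T Ps Pr lambda m.
  exact: (expected_excess_stationary T Ps_ge0 Pr_ge0
    s_uniform f_gaussian g_gaussian).
split=> [lambda n m _|]; first exact: stationary.
have c_gt0 : 0 < tau / success_probability K p0.
  rewrite divr_gt0// /success_probability mulr_gt0 ?exprn_gt0 ?subr_gt0//.
  by rewrite mulr_gt0// ltr0n.
have intX : P.-integrable setT
    (EFin \o (fun w => T / 2 * rate s f g Ps Pr 0 w)).
  rewrite (_ : EFin \o _ =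
    fun w => ((T / 2)%:E * (rate s f g Ps Pr 0 w)%:E)%E)//.
  apply: integrableZl => //.
  exact: (integrable_rate Ps_ge0 Pr_ge0 sigma2f_gt0
    s_uniform f_gaussian g_gaussian).
have [l [[l_ge0 El] l_uniq]] :=
  expected_excess_unique_crossing intX T_gt0 c_gt0.
(* The root found for index 0 serves every [n] by stationarity; [mulrA] regroups the right-hand side
   as [lambda] times the slope. *)
exists l => n; split=> [|m [m_ge0]].
  by split=> //; rewrite (stationary _ n 0%N) -mulrA.
by rewrite (stationary _ n 0%N) -mulrA => Em; apply: l_uniq; split.
Qed.
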